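(* Let $(X,\mathcal{A})$ be a measurable space and let $\mu\colon\mathcal{A}\to[0,\infty]$ be a nonadditive measure. Then $\mathcal{S}(X)$ is dense in $\mathcal{L}^\infty(\mu)$. If $\mu$ is weakly null-additive, then $S(X)$ is dense in $L^\infty(\mu)$.
   Context: $X$ is a nonempty set and $\mathcal{A}$ is a $\sigma$-field of subsets of $X$. A nonadditive measure is a set function $\mu\colon\mathcal{A}\to[0,\infty]$ with $\mu(\emptyset)=0$ and $\mu(A)\le\mu(B)$ whenever $A,B\in\mathcal{A}$, $A\subset B$. $\mathcal{F}_0(X)$ is the real linear space of all $\mathcal{A}$-measurable functions $X\to\mathbb{R}$; $\mathcal{S}(X)$ is the set of all $\mathcal{A}$-measurable simple functions (real-valued, taking finitely many values). Weakly null-additive: $\mu(A\cup B)=0$ whenever $A,B\in\mathcal{A}$ and $\mu(A)=\mu(B)=0$. For $f\in\mathcal{F}_0(X)$ let $\|f\|_\infty:=\inf\{c>0:\mu(\{|f|>c\})=0\}\in[0,\infty]$ (with $\inf\emptyset=\infty$) and $\mathcal{L}^\infty(\mu):=\{f\in\mathcal{F}_0(X):\|f\|_\infty<\infty\}$. For $\mu$ weakly null-additive, $f\sim g$ iff $\mu(\{|f-g|>c\})=0$ for every $c>0$ is an equivalence relation on $\mathcal{F}_0(X)$; $[f]$ is the class of $f$, with $[f]+[g]:=[f+g]$, $c[f]:=[cf]$; $L^\infty(\mu):=\{[f]:f\in\mathcal{L}^\infty(\mu)\}$, $\|[f]\|_\infty:=\|f\|_\infty$ (well-defined when $\mu$ is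 weakly null-additive), and $S(X):=\{[h]:h\in\mathcal{S}(X)\}$. A subset $D$ of such a space $V$ is dense if for any $x\in V$ and $\varepsilon>0$ there is $y\in D$ with $\|x-y\|_\infty<\varepsilon$. *)

(* Defs.v *)
From HB Require Import structures.
From mathcomp Require Import all_boot all_order all_algebra generic_quotient.
From mathcomp Require Import all_classical all_reals all_analysis.
From mathcomp Require Import measurable_realfun hoelder.
From mathcomp Require Import lra.

Set Implicit Arguments.
Unset Strict Implicit.
Unset Printing Implicit Defensive.

Import Order.TTheory GRing.Theory Num.Theory.
Import numFieldNormedType.Exports.

Local Open Scope classical_set_scope.
Local Open Scope ring_scope.
Local Open Scope quotient_scope.

(* As for the measures of MathComp-Analysis, [nam] is a total function on
   [set X], of which only the values on measurable sets matter.  The type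
   [measurableType d] is pointed, hence the space is nonempty. *)
Record nonadditive_measure d (X : measurableType d) (R : realType) :=
  NonadditiveMeasure {
    nam :> set X -> \bar R ;
    nam_ge0 : forall A, measurable A -> (0 <= nam A)%E ;
    nam0 : nam set0 = 0%E ;
    nam_le : forall A B, measurable A -> measurable B -> A `<=` B ->
      (nam A <= nam B)%E }.

Definition weakly_null_additive d (X : measurableType d) (R : realType)
    (mu : nonadditive_measure X R) :=
  forall A B, measurable A -> measurable B ->
    mu A = 0%E -> mu B = 0%E -> mu (A `|` B) = 0%E.

Section function_space.
Context d (X : measurableType d) (R : realType).
Context (mu : nonadditive_measure X R).

(* [ereal_inf set0 = +oo] *)
Definition infty_norm (f : {mfun X >-> R}) : \bar R :=
  ereal_inf [set c%:E | c in
    [set c : R | 0 < c /\ mu [set x | c < `|f x|] = 0%E]].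

Definition Linfty_funs : set {mfun X >-> R} :=
  [set f | (infty_norm f < +oo)%E].

End function_space.

Definition simple_funs d (X : measurableType d) (R : realType) :
    set {mfun X >-> R} :=
  [set h : {mfun X >-> R} | finite_set (range h)].
Arguments simple_funs {d} X R _.

Definition norm_dense (R : realType) (V : zmodType) (N : V -> \bar R)
    (D E : set V) :=
  D `<=` E /\
  forall x, E x -> forall e : R, 0 < e ->
    exists2 y, D y & (N (x - y)%R < e%:E)%E.

Section quotient_space.
Context d (X : measurableType d) (R : realType).
Context (mu : nonadditive_measure X R) (wna : weakly_null_additive mu).

Implicit Types f g h : {mfun X >-> R}.

Definition nam_equiv f g : bool :=
  `[< forall c : R, 0 < c -> mu [set x | c < `|f x - g x|] = 0%E >].

Lemma measurable_gt_norm f (c : R) : measurable [set x | c < `|f x|].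
Proof.
have mf : measurable_fun setT (fun x => `|f x|).
  exact: measurableT_comp.
have -> : [set x | c < `|f x|] = (fun x => `|f x|) @^-1` `]c, +oo[%classic.
  by apply/seteqP; split=> x /=; rewrite in_itv/= andbT.
by rewrite -[X in measurable X]setTI; exact: mf.
Qed.

Lemma nam_null_le A B : measurable A -> measurable B -> A `<=` B ->
  mu B = 0%E -> mu A = 0%E.
Proof.
move=> mA mB AB B0; apply/eqP; rewrite eq_le nam_ge0// andbT -B0.
exact: nam_le.
Qed.

Lemma nam_null_subU f g h (a b c : R) :
  [set x | c < `|h x|] `<=` [set x | a < `|f x|] `|` [set x | b < `|g x|] ->
  mu [set x | a < `|f x|] = 0%E -> mu [set x | b < `|g x|] = 0%E ->
  mu [set x | c < `|h x|] = 0%E.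
Proof.
move=> hfg f0 g0.
have mf := measurable_gt_norm f a; have mg := measurable_gt_norm g b.
apply: nam_null_le hfg _; [exact: measurable_gt_norm|exact: measurableU|].
exact: wna.
Qed.

Lemma nam_equivE f g : nam_equiv f g <->
  forall c : R, 0 < c -> mu [set x | c < `|(f - g : {mfun X >-> R}) x|] = 0%E.
Proof. by split=> [/asboolP|?]; [|exact/asboolP]. Qed.

Lemma nam_equiv_refl : reflexive nam_equiv.
Proof.
move=> f; apply/nam_equivE => c c0; rewrite subrr.
rewrite (_ : [set _ | _] = set0) ?nam0//.
by apply/seteqP; split=> x //=; rewrite normr0 ltNge (ltW c0).
Qed.

Lemma nam_equiv_sym : symmetric nam_equiv.
Proof.
move=> f g; apply/idP/idP => /asboolP fg; apply/asboolP => c /fg <-;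
by congr (mu _); apply/seteqP; split=> x /=; rewrite distrC.
Qed.

Lemma nam_equiv_trans : transitive nam_equiv.
Proof.
move=> g f h /nam_equivE fg /nam_equivE gh; apply/nam_equivE => c c0.
apply: (@nam_null_subU (f - g) (g - h) _ (c / 2) (c / 2)); first last.
- by apply: gh; lra.
- by apply: fg; lra.
move=> x /= cx; have := ler_normD (f x - g x) (g x - h x).
rewrite addrA subrK => le_fh.
have [?|le_fg] := ltP (c / 2) `|f x - g x|; [by left|right].
by rewrite [X in _ < X](_ : _ = `|g x - h x|)//; move: cx; lra.
Qed.

Definition nam_equiv_rel :=
  EquivRel nam_equiv nam_equiv_refl nam_equiv_sym nam_equiv_trans.

(* The quotient of the space of all measurable functions by [nam_equiv]. *)
Definition mfun_quot : Type := {eq_quot nam_equiv_rel}.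
HB.instance Definition _ := Choice.on mfun_quot.
HB.instance Definition _ := EqQuotient.on mfun_quot.

Definition mfun_class (f : {mfun X >-> R}) : mfun_quot := \pi f.

Lemma mfun_classE f g : mfun_class f = mfun_class g <-> nam_equiv f g.
Proof. by split=> [/eqmodP|?]; [|exact/eqmodP]. Qed.

Lemma nam_equiv_repr f : nam_equiv (repr (mfun_class f)) f.
Proof. by apply/mfun_classE; rewrite /mfun_class reprK. Qed.

Lemma nam_equivD f f' g g' :
  nam_equiv f f' -> nam_equiv g g' -> nam_equiv (f + g) (f' + g').
Proof.
move=> /nam_equivE ff /nam_equivE gg; apply/nam_equivE => c c0.
apply: (@nam_null_subU (f - f') (g - g') _ (c / 2) (c / 2)); first last.
- by apply: gg; lra.
- by apply: ff; lra.
move=> x /= cx; have := ler_normD (f x - f' x) (g x - g' x).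
rewrite addrACA -opprD => le_fg.
have [?|le_ff] := ltP (c / 2) `|f x - f' x|; [by left|right].
by rewrite [X in _ < X](_ : _ = `|g x - g' x|)//; move: cx; lra.
Qed.

Lemma nam_equivZ (a : R) f f' :
  nam_equiv f f' -> nam_equiv (a *: f) (a *: f').
Proof.
move=> ff; have [->|a0] := eqVneq a 0; first by rewrite !scale0r nam_equiv_refl.
move/nam_equivE : ff => ff; apply/nam_equivE => c c0.
rewrite -scalerBr -(ff (c / `|a|)) ?divr_gt0 ?normr_gt0//.
congr (mu _); apply/seteqP; split=> x /=;
by rewrite normrM ltr_pdivrMr ?normr_gt0// mulrC.
Qed.

Definition mfun_quot_add (p q : mfun_quot) := mfun_class (repr p + repr q).
Definition mfun_quot_opp (p : mfun_quot) := mfun_class (- repr p).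
Definition mfun_quot_scale (a : R) (p : mfun_quot) := mfun_class (a *: repr p).

Lemma mfun_quot_addE f g :
  mfun_quot_add (mfun_class f) (mfun_class g) = mfun_class (f + g).
Proof. by apply/mfun_classE/nam_equivD; exact: nam_equiv_repr. Qed.

Lemma mfun_quot_oppE f : mfun_quot_opp (mfun_class f) = mfun_class (- f).
Proof.
apply/mfun_classE; have := nam_equivZ (-1) (nam_equiv_repr f).
by rewrite !scaleN1r.
Qed.

Lemma mfun_quot_scaleE a f :
  mfun_quot_scale a (mfun_class f) = mfun_class (a *: f).
Proof. exact/mfun_classE/nam_equivZ/nam_equiv_repr. Qed.

Lemma mfun_class_ind (P : mfun_quot -> Prop) :
  (forall f, P (mfun_class f)) -> forall p, P p.
Proof. by move=> Pf p; rewrite -[p]reprK; exact: Pf. Qed.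

Lemma mfun_quot_addA : associative mfun_quot_add.
Proof.
elim/mfun_class_ind=> f; elim/mfun_class_ind=> g; elim/mfun_class_ind=> h.
by rewrite !mfun_quot_addE addrA.
Qed.

Lemma mfun_quot_addC : commutative mfun_quot_add.
Proof.
elim/mfun_class_ind=> f; elim/mfun_class_ind=> g.
by rewrite !mfun_quot_addE addrC.
Qed.

Lemma mfun_quot_add0 : left_id (mfun_class 0) mfun_quot_add.
Proof. by elim/mfun_class_ind=> f; rewrite mfun_quot_addE add0r. Qed.

Lemma mfun_quot_addN :
  left_inverse (mfun_class 0) mfun_quot_opp mfun_quot_add.
Proof.
by elim/mfun_class_ind=> f; rewrite mfun_quot_oppE mfun_quot_addE addNr.
Qed.

HB.instance Definition _ := GRing.isZmodule.Build mfun_quot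
  mfun_quot_addA mfun_quot_addC mfun_quot_add0 mfun_quot_addN.

Lemma mfun_classD f g : mfun_class (f + g) = mfun_class f + mfun_class g.
Proof. exact/esym/mfun_quot_addE. Qed.

Lemma mfun_quot_scaleA a b p :
  mfun_quot_scale a (mfun_quot_scale b p) = mfun_quot_scale (a * b) p.
Proof. by elim/mfun_class_ind: p => f; rewrite !mfun_quot_scaleE scalerA. Qed.

Lemma mfun_quot_scale1 : left_id 1 mfun_quot_scale.
Proof. by elim/mfun_class_ind=> f; rewrite mfun_quot_scaleE scale1r. Qed.

Lemma mfun_quot_scaleDr : right_distributive mfun_quot_scale +%R.
Proof.
move=> a; elim/mfun_class_ind=> f; elim/mfun_class_ind=> g.
by rewrite -mfun_classD !mfun_quot_scaleE scalerDr mfun_classD.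
Qed.

Lemma mfun_quot_scaleDl p :
  {morph mfun_quot_scale^~ p : a b / a + b >-> a + b}.
Proof.
elim/mfun_class_ind: p => f a b.
by rewrite !mfun_quot_scaleE scalerDl mfun_classD.
Qed.

HB.instance Definition _ := GRing.Zmodule_isLmodule.Build R mfun_quot
  mfun_quot_scaleA mfun_quot_scale1 mfun_quot_scaleDr mfun_quot_scaleDl.

Lemma mfun_classB f g : mfun_class (f - g) = mfun_class f - mfun_class g.
Proof. by rewrite mfun_classD; congr (_ + _); exact/esym/mfun_quot_oppE. Qed.

Lemma mfun_classZ a f : mfun_class (a *: f) = a *: mfun_class f.
Proof. exact/esym/mfun_quot_scaleE. Qed.

Lemma infty_norm_equiv_le f g : nam_equiv f g ->
  (infty_norm mu g <= infty_norm mu f)%E.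
Proof.
move=> /nam_equivE fg; apply: le_ereal_inf_tmp => _ [c [c0 fc] <-].
apply/lee_addgt0Pr => e e0; apply: ereal_inf_lbound; exists (c + e) => //.
split; first by rewrite addr_gt0.
apply: (@nam_null_subU f (f - g) _ c e) => //; last exact: fg.
move=> x /= cx; have := ler_normB (f x) (f x - g x).
rewrite subKr => le_g.
have [?|le_f] := ltP c `|f x|; [by left|right].
by rewrite [X in _ < X](_ : _ = `|f x - g x|)//; move: cx; lra.
Qed.

Lemma infty_norm_equiv f g : nam_equiv f g ->
  infty_norm mu f = infty_norm mu g.
Proof.
move=> fg; apply/eqP; rewrite eq_le !infty_norm_equiv_le//.
by rewrite nam_equiv_sym.
Qed.

Definition class_infty_norm (p : mfun_quot) : \bar R := infty_norm mu (repr p).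

Lemma class_infty_norm_class f : class_infty_norm (mfun_class f) = infty_norm mu f.
Proof. exact/infty_norm_equiv/nam_equiv_repr. Qed.

Definition Linfty_classes : set mfun_quot := [set mfun_class f | f in Linfty_funs mu].

Definition simple_classes : set mfun_quot :=
  [set mfun_class h | h in simple_funs X R].

End quotient_space.

Arguments mfun_class {d X R mu} wna f.
Arguments class_infty_norm {d X R mu} wna p.
Arguments Linfty_classes {d X R mu} wna _.
Arguments simple_classes {d X R mu} wna _.

(* Main.v *)
Require Import Defs.
From mathcomp Require Import all_boot all_order all_algebra.
From mathcomp Require Import all_classical all_reals all_analysis.
From mathcomp Require Import measurable_realfun hoelder.
From mathcomp Require Import lra.

Import Order.TTheory GRing.Theory Num.Theory.

Local Open Scope classical_set_scope.
Local Open Scope ring_scope.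

(* A function with finite norm satisfies [|f| <= c] off a null set.  Rounding
   values down to the grid of mesh [e] on [[-c, c]] is a nondecreasing, hence
   Borel, map [R -> R] with finite range, at distance at most [e] from the
   identity on [[-c, c]]; composing it with [f] gives the simple
   approximation. *)

Section step.
Context {R : realType}.
Implicit Types c e t : R.

(* [Num.truncn] vanishes on negative reals, so no lower cut-off is needed. *)
Definition step c e t : R :=
  e * (Num.truncn (Num.min (t + c) (c + c) / e))%:R - c.

Lemma step_nondecreasing c e : 0 < e ->
  {homo step c e : s t / s <= t}.
Proof.
move=> e0 s t st; rewrite /step lerB// ler_pM2l// ler_nat le_truncn//.
by rewrite ler_pM2r ?invr_gt0// le_min2 ?lerD2r.
Qed.

Lemma measurable_step c e : 0 < e -> measurable_fun setT (step c e).
Proof.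
by move=> e0; apply: nondecreasing_measurable => // s t; exact: step_nondecreasing.
Qed.

Lemma finite_range_step c e : 0 < e -> finite_set (range (step c e)).
Proof.
move=> e0.
(* The cap [c + c] bounds the grid index; the successor keeps the largest index in the range. *)
apply: (@sub_finite_set _ _ ((fun n : nat => e * n%:R - c) @`
    `I_(Num.truncn ((c + c) / e)).+1)); last exact/finite_image/finite_II.
move=> _ [t _ <-].
exists (Num.truncn (Num.min (t + c) (c + c) / e)) => //=.
by rewrite ltnS le_truncn// ler_pM2r ?invr_gt0// ge_min lexx orbT.
Qed.

Lemma step_dist c e t : 0 < e -> `|t| <= c -> `|t - step c e t| <= e.
Proof.
move=> e0; rewrite ler_norml => /andP[ct tc].
(* As [t <= c], the cap is inactive; with [n] the truncation, [n * e <= t + c < (n + 1) * e], so [t]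
   exceeds its grid value by less than [e]. *)
rewrite /step min_l ?lerD2r//.
have /truncn_itv/andP[] : 0 <= (t + c) / e by rewrite divr_ge0 ?(ltW e0)//; lra.
set n := Num.truncn _.
rewrite ler_pdivlMr// ltr_pdivrMr// -natr1 mulrDl mul1r => nle ltn.
by rewrite ler_norml [e * _]mulrC; apply/andP; split; lra.
Qed.

End step.

Section infty_norm.
Context {d} {X : measurableType d} {R : realType}.
Context (mu : nonadditive_measure X R).
Implicit Types f h : {mfun X >-> R}.

Lemma infty_norm_le f (c : R) : 0 < c ->
  mu [set x | c < `|f x|] = 0%E -> (infty_norm mu f <= c%:E)%E.
Proof. by move=> c0 fc; apply: ereal_inf_lbound; exists c. Qed.

Lemma simple_funs_Linfty : simple_funs X R `<=` Linfty_funs mu.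
Proof.
move=> h /= /finite_seqP[s hs].
(* Starting the maximum at 1 makes [M] positive, as the infimum ranges over positive bounds only; no
   value of [|h|] exceeds [M]. *)
pose M := \big[Order.max/1]_(y <- s) `|y|.
have M0 : 0 < M by rewrite (lt_le_trans ltr01)// bigmax_ge_id.
apply: (@le_lt_trans _ _ M%:E); last exact: ltry.
apply: infty_norm_le => //.
rewrite (_ : [set _ | _] = set0) ?nam0//.
apply/seteqP; split=> x //=; rewrite ltNge.
have : range h (h x) by exists x.
by rewrite hs /= => xs; rewrite (le_bigmax_seq _ _ _ _ xs).
Qed.

Lemma simple_funs_approx f (e : R) : Linfty_funs mu f -> 0 < e ->
  exists2 h, simple_funs X R h & (infty_norm mu (f - h)%R < e%:E)%E.
Proof.
move=> /ereal_inf_lt[_ [c [c0 fc] <-] _] e0.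
(* Mesh [e / 2]: the norm bound obtained from it is not strict, whereas density asks for a strict
   one. *)
have e20 : 0 < e / 2 by rewrite divr_gt0.
have mh : measurable_fun setT (step c (e / 2) \o f).
  by apply: measurableT_comp; [exact: measurable_step|].
pose h : {mfun X >-> R} := mfun_Sub (mem_set mh).
have hE x : h x = step c (e / 2) (f x) by [].
exists h.
  apply: sub_finite_set (@finite_range_step R c _ e20) => _ [x _ <-].
  by rewrite hE; exists (f x).
apply: (@le_lt_trans _ _ (e / 2)%:E); last by rewrite lte_fin; lra.
apply: infty_norm_le => //.
(* By [step_dist], an error above [e / 2] forces [|f x| > c], so the exceptional set lies in a null
   set. *)
apply: nam_null_le fc; [exact: measurable_gt_norm..|].
move=> x /=; rewrite !ltNge; apply: contra => /(step_dist _ _ _ e20).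
by rewrite -hE.
Qed.

End infty_norm.

Theorem theorem8p4 (d : measure_display) (X : measurableType d)
    (R : realType) (mu : nonadditive_measure X R) :
  norm_dense (infty_norm mu) (simple_funs X R) (Linfty_funs mu) /\
  (forall wna : weakly_null_additive mu,
    norm_dense (class_infty_norm wna) (simple_classes wna)
      (Linfty_classes wna)).
Proof.
split=> [|wna]; split.
- exact: simple_funs_Linfty.
- by move=> f ff e; exact: simple_funs_approx.
- exact/image_subset/simple_funs_Linfty.
(* The class norm can be computed on any representative, so the approximation of [f] by [h] passes
   to the classes. *)
- move=> _ [f ff <-] e /(simple_funs_approx mu _ _ ff)[h hS fh].
  exists (mfun_class wna h); first by exists h.
  by rewrite -mfun_classB class_infty_norm_class.
Qed.
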